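(* Let $M$ be a closed, connected, orientable, triangulated $n$-manifold. Suppose $M$ has a spine $N$ that admits a component-perfect multidimensional discrete Morse (MDM) function $g:N\to\mathbb{R}^k$. Then $g$ can be extended to a component-perfect MDM function $f:M\to\mathbb{R}^k$ (that is, there is a component-perfect MDM function $f$ on $M$ with $f|_N=g$).
   Context: Cells and order. Let $K$ be a finite regular CW complex (for instance a finite simplicial complex, such as a triangulated closed manifold), identified with its set of open cells; $K_p$ is the set of $p$-cells. For cells $\sigma,\tau$, write $\sigma\subseteq\tau$ if $\sigma$ is contained in the closure of $\tau$ ($\sigma$ is a face of $\tau$, $\tau$ a coface of $\sigma$), and $\sigma\subset\tau$ if moreover $\sigma\ne\tau$. For a set $S$ of cells, $\mathrm{Cl}(S)=\{\sigma\in K: \sigma\subseteq\tau \text{ for some }\tau\in S\}$ and $\mathrm{Ex}(S)=\mathrm{Cl}(S)\setminus S$. On $\mathbb{R}^k$ ($k\ge1$), $a\preceq b$ means $a_i\le b_i$ for all $i$, and $a\prec b$ means $a\preceq b$ and $a\ne b$. $\beta_p(K)$ is the rank of $H_p(K;\mathbb{Z})$. Collapses and spines. If $\sigma$ is a $p$-cell and $\tau$ a $(p+1)$-cell of $K$ with $\sigma\subset\tau$ and no other $(p+1)$-cell of $K$ has $\sigma$ as a face, then $(\sigma,\tau)$ is a collapse pair in $K$. $K$ collapses to a subcomplex $L$ if $L$ is obtained from $K$ by successively removing a finite sequence of collapse pairs (each being a collapse pair in the complex remaining at that stage). If $W$ is a compact, connected, triangulated $n$-manifold with boundary, a subcomplex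 $N$ of $W$ of dimension $d\le n-1$ is a spine of $W$ if $W$ collapses onto $N$ and no further collapses are possible on $N$. If $M$ is a closed triangulated $n$-manifold, a spine of $M$ is a spine of $M\setminus\sigma^{(n)}$ for some open $n$-cell $\sigma^{(n)}$ of $M$ (i.e. a subcomplex of dimension $\le n-1$ onto which the subcomplex $M\setminus\sigma^{(n)}$ collapses and which admits no further collapses). MDM functions. For $f=(f_1,\dots,f_k):K\to\mathbb{R}^k$ (a function on cells) and $\sigma\in K_p$, put $H_f(\sigma)=\{\beta\in K_{p+1}:\beta\supset\sigma,\ f(\beta)\preceq f(\sigma)\}$ and $T_f(\sigma)=\{\alpha\in K_{p-1}:\alpha\subset\sigma,\ f(\alpha)\succeq f(\sigma)\}$. $f$ is an MDM function if for every $p$ and every $\sigma\in K_p$: (1) $|H_f(\sigma)|\le 1$; (2) $|T_f(\sigma)|\le1$; (3) if $\beta\in K_{p+1}$, $\beta\supset\sigma$, $\beta\notin H_f(\sigma)$, then $f(\beta)\succ f(\sigma)$; (4) if $\alpha\in K_{p-1}$, $\alpha\subset\sigma$, $\alpha\notin T_f(\sigma)$, then $f(\alpha)\prec f(\sigma)$. A cell $\sigma$ is critical if $|H_f(\sigma)|=|T_f(\sigma)|=0$. The gradient vector field of $f$ is $\mathcal{V}=\{(\sigma,\beta): \dim\beta=\dim\sigma+1,\ \sigma\subset\beta,\ f(\beta)\preceq f(\sigma)\}$. Reachability. For cells $\alpha,\beta\in K$, write $\alpha\to_{\mathcal{V}}\beta$ if there is a finite sequence $\alpha\supseteq\sigma_0\subset\tau_0\supset\sigma_1\subset\tau_1\supset\cdots\supset\sigma_r\subseteq\beta$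 ($r\ge 0$) with $(\sigma_i,\tau_i)\in\mathcal{V}$ for $0\le i<r$ and with either $\beta=\sigma_r$ or $(\sigma_r,\beta)\in\mathcal{V}$. (Faces here may have any codimension.) Critical components. For critical cells $\sigma,\tau$, write $\sigma\to_f\tau$ if $\sigma\to_{\mathcal{V}}\tau$ and $f_i(\sigma)=f_i(\tau)$ for some $i\in\{1,\dots,k\}$. Let $\sim$ be the equivalence relation on the set $\mathcal{C}$ of critical cells generated by $\to_f$; its classes $[\sigma]$ are the critical components of $f$. An $f$-cycle is a sequence of critical components $[\sigma_0],[\sigma_1],\dots,[\sigma_n]=[\sigma_0]$, at least two of which are distinct, such that for each $i\in\{1,\dots,n\}$ there are critical cells $\tau'\sim\sigma_{i-1}$ and $\tau\sim\sigma_i$ with $\tau'\to_f\tau$. $f$ is acyclic if it has no $f$-cycle. Morse sets and Conley coefficients. For acyclic $f$, the Morse set of $[\sigma]$ is $M([\sigma])=\bigcup_{\tau,\tau'\in[\sigma]}\{\beta\in K:\tau'\to_{\mathcal{V}}\beta\to_{\mathcal{V}}\tau\}$. Its $p$-th Conley coefficient is $\mathrm{con}_p(M([\sigma]))=\mathrm{rank}\,H_p(\mathrm{Cl}(M([\sigma])),\mathrm{Ex}(M([\sigma]));\mathbb{Z})$, and $m_p=\sum_{[\sigma]\in\mathcal{C}/\sim}\mathrm{con}_p(M([\sigma]))$. Perfection. An acyclic MDM function $f:K\to\mathbb{R}^k$ is component-perfect if $m_p=\beta_p(K)$ for all $p\ge0$. *)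

(* Defs.v *)
From HB Require Import structures.
From mathcomp Require Import all_boot all_order all_algebra.
From mathcomp Require Import all_classical all_reals all_analysis.
(* finset last: its set0 (rather than that of classical_sets) is the default *)
From mathcomp Require Import finset.
Set Implicit Arguments.
Unset Strict Implicit.
Unset Printing Implicit Defensive.
Import Order.TTheory GRing.Theory Num.Theory.
Import numFieldNormedType.Exports.
Local Open Scope ring_scope.

Section Complexes.
Variable V : finType.
Implicit Types (s t : {set V}) (K L N W A B : {set {set V}}).

(* A cell is the (nonempty) set of its vertices; a p-cell has p + 1 vertices. *)
Definition is_complex K : Prop :=
  set0 \notin K /\
  forall s t, s \in K -> t \subset s -> t != set0 -> t \in K.

Definition dim_cell (p : nat) s : bool := #|s| == p.+1.

Definition facet s t : bool := (s \subset t) && (#|t| == #|s|.+1).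

Definition Cl K A : {set {set V}} :=
  [set s in K | [exists t in A, s \subset t]].

Definition Ex K A : {set {set V}} := Cl K A :\: A.

Definition collapse_pair K s t : Prop :=
  [/\ s \in K, t \in K, facet s t
    & forall t', t' \in K -> facet s t' -> t' = t].

Inductive collapses : {set {set V}} -> {set {set V}} -> Prop :=
| collapses_refl K : collapses K K
| collapses_step K L s t :
    collapse_pair K s t -> collapses (K :\: [set s; t]) L -> collapses K L.

(* The dimension bound dim N <= n - 1 is stated without subtraction, so that
   for n = 0 it forces N to be empty. *)
Definition is_spine (n : nat) W N : Prop :=
  [/\ is_complex W, is_complex N /\ N \subset W,
      forall s, s \in N -> (#|s| <= n)%N,
      collapses W N
    & forall s t, ~ collapse_pair N s t].

Definition is_closed_spine (n : nat) K N : Prop :=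
  exists s, [/\ s \in K, dim_cell n s & is_spine n (K :\ s) N].

Definition chain : Type := {ffun {set V} -> int}.

Definition in_chains A (p : nat) (c : chain) : Prop :=
  forall s, c s != 0 -> s \in A /\ dim_cell p s.

(* Cells are oriented by the enumeration order of V: the face v |: s minus v
   has incidence (-1)^i in v |: s, where i is the position of v.  The test
   s != set0 makes the boundary of 0-chains vanish (unreduced homology). *)
Definition boundary (c : chain) : chain :=
  [ffun s : {set V} =>
    \sum_(v | (s != set0) && (v \notin s))
       (-1) ^+ #|[set w in s | (enum_rank w < enum_rank v)%N]| * c (v |: s)].

Definition supported_on B (c : chain) : Prop := forall s, c s != 0 -> s \in B.

Definition rel_cycle A B (p : nat) (c : chain) : Prop :=
  in_chains A p c /\ supported_on B (boundary c).

Definition rel_boundary A B (p : nat) (c : chain) : Prop :=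
  exists d : chain, in_chains A p.+1 d /\ supported_on B (c - boundary d).

(* The classes of z_0, ..., z_{r-1} are Z-linearly independent in
   H_p(A, B; Z) = rel_cycle A B p / rel_boundary A B p. *)
Definition homology_independent A B (p r : nat) (z : 'I_r -> chain) : Prop :=
  (forall i, rel_cycle A B p (z i)) /\
  forall a : 'I_r -> int,
    rel_boundary A B p (\sum_(i < r) z i *~ a i) -> forall i, a i = 0.

(* The maximal number of Z-linearly independent classes.  The bound r <= #|A|
   loses nothing: the chain group of A is free of rank at most #|A|. *)
Definition rank_homology A B (p : nat) : nat :=
  \max_(r < #|A|.+1 | `[< exists z, @homology_independent A B p r z >]) r.

Definition betti K (p : nat) : nat := rank_homology K set0 p.

(* All n-cells can be oriented (sign o t relative to the orientation given by
   the enumeration order) so that their sum is a cycle. *)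
Definition orientable (n : nat) K : Prop :=
  exists o : chain,
    [/\ forall t, t \in K -> dim_cell n t -> o t = 1 \/ o t = -1,
        in_chains K n o
      & boundary o = 0].

End Complexes.

Section Manifolds.
Variable R : realType.

Definition homeomorphic (S T : topologicalType) (X : set S) (Y : set T) : Prop :=
  exists (f : S -> T) (g : T -> S),
    [/\ {within X, continuous f}%classic, {within Y, continuous g}%classic,
        forall x, X x -> Y (f x) /\ g (f x) = x
      & forall y, Y y -> X (g y) /\ f (g y) = y].

(* Subspaces of R^m are automatically Hausdorff and second countable. *)
Definition closed_manifold (n m : nat) (X : set 'rV[R]_m) : Prop :=
  compact X /\
  forall x, X x -> exists (U : set 'rV[R]_m) (W : set 'rV[R]_n),
    [/\ open U, U x, open W & homeomorphic (X `&` U)%classic W].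

(* Points are given by their barycentric coordinates. *)
Definition realization (V : finType) (K : {set {set V}}) : set 'rV[R]_#|V| :=
  [set x : 'rV[R]_#|V| |
    [/\ forall v : V, 0 <= x 0 (enum_rank v),
        \sum_(v : V) x 0 (enum_rank v) = 1
      & [set v | x 0 (enum_rank v) != 0]%SET \in K]]%classic.

Definition triangulated_closed_manifold (V : finType) (n : nat)
    (K : {set {set V}}) : Prop :=
  is_complex K /\ closed_manifold n (realization K).

End Manifolds.
Arguments realization R {V} K.

Section MDM.
Variables (R : realType) (V : finType) (k : nat).
Variables (K : {set {set V}}) (f : {set V} -> 'rV[R]_k).
Implicit Types (s t : {set V}) (C D : {set {set V}}).

Definition preceq (a b : 'rV[R]_k) : bool := [forall i, a 0 i <= b 0 i].
Definition prec (a b : 'rV[R]_k) : bool := preceq a b && (a != b).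

Definition Hset s : {set {set V}} :=
  [set b in K | facet s b && preceq (f b) (f s)].
Definition Tset s : {set {set V}} :=
  [set a in K | facet a s && preceq (f s) (f a)].

Definition is_mdm : Prop :=
  forall s, s \in K ->
    [/\ (#|Hset s| <= 1)%N,
        (#|Tset s| <= 1)%N,
        forall b, b \in K -> facet s b -> b \notin Hset s -> prec (f s) (f b)
      & forall a, a \in K -> facet a s -> a \notin Tset s -> prec (f a) (f s)].

Definition critical : {set {set V}} :=
  [set s in K | (Hset s == set0) && (Tset s == set0)].

Definition gvf s t : bool :=
  [&& s \in K, t \in K, facet s t & preceq (f t) (f s)].

Definition vstep s s' : bool :=
  [exists t, [&& gvf s t, s' \in K & s' \proper t]].

(* vstep chains sigma_i to sigma_(i+1) through tau_i; a starts the sequence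
   above sigma_0 and b ends it at or above sigma_r. *)
Definition reach (a b : {set V}) : bool :=
  [exists s0 in K, exists sr in K,
     [&& s0 \subset a, connect vstep s0 sr & (b == sr) || gvf sr b]].

Definition link s t : bool :=
  [&& s \in critical, t \in critical, reach s t & [exists i, f s 0 i == f t 0 i]].

Definition link_equiv : rel {set V} :=
  connect [rel s t | link s t || link t s].

Definition components : {set {set {set V}}} :=
  equivalence_partition link_equiv critical.

Definition component_link C D : bool :=
  [exists s in C, exists t in D, link s t].

(* c = [:: [sigma_0]; ...; [sigma_(n-1)]], the return to [sigma_0] being
   implicit in cycle. *)
Definition f_cycle (c : seq {set {set V}}) : Prop :=
  [/\ {subset c <= components}, cycle component_link c
    & exists C D, [/\ C \in c, D \in c & C <> D]].

Definition acyclic : Prop := forall c, ~ f_cycle c.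

Definition morse_set C : {set {set V}} :=
  [set b in K | [exists t in C, exists t' in C, reach t' b && reach b t]].

Definition conley C (p : nat) : nat :=
  rank_homology (Cl K (morse_set C)) (Ex K (morse_set C)) p.

Definition morse_number (p : nat) : nat :=
  (\sum_(C in components) conley C p)%N.

Definition component_perfect : Prop :=
  [/\ is_mdm, acyclic & forall p, morse_number p = betti K p].

End MDM.

(* Main.v *)
(* Extend g over the collapses of M minus an n-cell sigma onto N, undone in
   reverse order, and finally over sigma: the cells added at each stage share
   one constant vector, larger in every coordinate than all earlier values.
   A collapse pair then becomes a gradient pair and changes neither the critical
   components nor their Morse sets, while sigma becomes a critical component by
   itself with Conley coefficient 1 in degree n and 0 elsewhere.  Collapses
   preserve the Betti numbers, and the orientation n-cycle, having coefficient
   +1 or -1 at sigma, shows that adding sigma raises only the n-th one, by 1. *)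
From HB Require Import structures.
Require Import Defs.
From mathcomp Require Import all_boot all_order all_algebra.
From mathcomp Require Import all_classical all_reals all_analysis.
From mathcomp Require Import finset ring.
Set Implicit Arguments.
Unset Strict Implicit.
Unset Printing Implicit Defensive.
Import Order.TTheory GRing.Theory Num.Theory.
Import numFieldNormedType.Exports.
Local Open Scope ring_scope.

(** * Homology ranks *)

Section Homology.
Variable V : finType.
Implicit Types (s t : {set V}) (K L A B : {set {set V}}) (c d : chain V).

(** * Facets, chains and the boundary operator *)

Lemma facetP s t :
  reflect (exists2 v, v \notin s & t = v |: s) (facet s t).
Proof.
apply: (iffP andP) => [[sub_st /eqP card_t]|[v vs ->]]; last first.
  by rewrite finset.subsetUr cardsU1 vs.
have /eqP/cards1P[v def_v] : #|t :\: s| = 1%N.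
  by rewrite cardsD (finset.setIidPr sub_st) card_t subSn // subnn.
have : v \in t :\: s by rewrite def_v set11.
rewrite inE => /andP[vs vt]; exists v => //.
rewrite -def_v finset.setUC -[LHS](finset.setID t s).
by rewrite (finset.setIidPr sub_st).
Qed.

(** Evaluation at a cell gets a name so that it can carry an additive structure; the [raddf] lemmas
    then evaluate sums, differences and integer multiples. *)
Definition coeff s (c : chain V) : int := c s.

Fact coeff_is_additive s : zmod_morphism (coeff s).
Proof. by move=> c d; rewrite /coeff !ffunE. Qed.

HB.instance Definition _ s :=
  GRing.isZmodMorphism.Build (chain V) int (coeff s) (coeff_is_additive s).

Fact boundary_is_additive : zmod_morphism (@boundary V).
Proof.
move=> c d; apply/ffunP=> s; rewrite !ffunE -sumrB.
by apply: eq_bigr => v _; rewrite !ffunE mulrBr.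
Qed.

HB.instance Definition _ :=
  GRing.isZmodMorphism.Build (chain V) (chain V) (@boundary V)
    boundary_is_additive.

Lemma chainD c d s : (c + d) s = c s + d s.
Proof. exact: (raddfD (coeff s)). Qed.
Lemma chainB c d s : (c - d) s = c s - d s.
Proof. exact: (raddfB (coeff s)). Qed.
Lemma chainMz c m s : (c *~ m) s = c s * m.
Proof. by rewrite -[LHS]/(coeff s _) raddfMz -mulrzr intz. Qed.
Lemma chain0 s : (0 : chain V) s = 0. Proof. exact: (raddf0 (coeff s)). Qed.
Lemma chain_sum (I : finType) (F : I -> chain V) s :
  (\sum_i F i) s = \sum_i F i s.
Proof. exact: (raddf_sum (coeff s)). Qed.

Lemma boundary0 : boundary (0 : chain V) = 0.
Proof. exact: (raddf0 (@boundary V)). Qed.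
Lemma boundaryD c d : boundary (c + d) = boundary c + boundary d.
Proof. exact: (raddfD (@boundary V)). Qed.
Lemma boundaryB c d : boundary (c - d) = boundary c - boundary d.
Proof. exact: (raddfB (@boundary V)). Qed.
Lemma boundaryMz c m : boundary (c *~ m) = boundary c *~ m.
Proof. exact: (raddfMz (@boundary V)). Qed.
Lemma boundary_sum (I : finType) (F : I -> chain V) :
  boundary (\sum_i F i) = \sum_i boundary (F i).
Proof. exact: (raddf_sum (@boundary V)). Qed.

Definition chainE := (chainB, chainD, chainMz, chain0, chain_sum).

Lemma boundary_neq0 c s :
  boundary c s != 0 -> s != set0 /\ exists2 v, v \notin s & c (v |: s) != 0.
Proof.
rewrite ffunE => nz; suff /existsP[v /andP[/andP[s0 vs] cv]] :
  [exists v, (s != set0) && (v \notin s) && (c (v |: s) != 0)].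
  by split=> //; exists v.
apply: contraR nz => /existsPn no_v; apply/eqP/big1 => v Pv.
by have := no_v v; rewrite Pv negbK => /eqP->; rewrite mulr0.
Qed.

(** Adding [v] and then [u] to [s] gives the same cell as the other order but the opposite sign, so
    the double sum equals its own negative and vanishes in [int]. *)
Lemma boundaryK c : boundary (boundary c) = 0.
Proof.
apply/ffunP=> s; rewrite chain0 ffunE.
have [->|s0] /= := eqVneq s set0; first by rewrite big_pred0.
pose before (u v : V) := (enum_rank u < enum_rank v)%N.
pose pos v := #|[set w in s | before w v]|.
(* The position of [u] is counted in [s]; the extra [before v u] corrects it to the position in
   [v |: s]. *)
pose F v u : int := if (u \notin s) && (u != v) then
  (-1) ^+ (pos v + (pos u + before v u)) * c (u |: (v |: s)) else 0.
have antisymF v u : v \notin s -> u \notin s -> F v u = - F u v.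
  move=> vs us; rewrite /F vs us /= [v == u]eq_sym.
  have [//|neq_uv] := eqVneq u v.
  rewrite /= finset.setUCA -mulNr; congr (_ * _); rewrite -[RHS]mulN1r -exprS.
  (* Exactly one of two distinct vertices precedes the other, so swapping them changes the parity of
     the exponent. *)
  have -> : before v u = ~~ before u v.
    rewrite /before -leqNgt [RHS]leq_eqVlt orb_idl // => /eqP e.
    by case/eqP: neq_uv; apply/enum_rank_inj/val_inj.
  rewrite -signr_odd -[in RHS]signr_odd /= !oddD.
  by do 2!case: odd; case: (before u v).
pose S := \sum_(v | v \notin s) \sum_(u | u \notin s) F v u.
have -> : \sum_(v | v \notin s)
    (-1) ^+ #|[set w in s | before w v]| * boundary c (v |: s) = S.
  apply: eq_bigr => v vs; rewrite ffunE big_distrr /=.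
  rewrite [RHS]big_mkcond [LHS]big_mkcond; apply: eq_bigr => u _ /=.
  have -> /= : v |: s != set0 by apply/set0Pn; exists v; rewrite setU11.
  rewrite !inE negb_or andbC /F.
  case: ifPn => [/andP[us uv]|]; last by case: ifP.
  rewrite us mulrA -exprD; congr (_ ^+ (_ + _) * _).
  rewrite -/(before _ _); have [lt_vu|le_uv] := boolP (before v u).
    have -> : [set w in v |: s | before w u] = v |: [set w in s | before w u].
      by apply/setP=> w; rewrite !inE andb_orl; case: eqP => // ->;
        rewrite lt_vu.
    by rewrite cardsU1 inE (negPf vs) /= addnC.
  rewrite addn0; congr #|pred_of_set _|; apply/setP=> w; rewrite !inE andb_orl.
  by case: eqP => // ->; rewrite -/(before v u) (negPf le_uv) (negPf vs).
have : S = - S.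
  rewrite {1}/S exchange_big /= -sumrN; apply: eq_bigr => u us.
  by rewrite -sumrN; apply: eq_bigr => v vs; rewrite antisymF.
by move=> /eqP; rewrite -addr_eq0 -mulr2n mulrn_eq0 => /eqP.
Qed.

(** * Chains of a complex and their supports *)

Lemma boundary_in_chains K p c :
  is_complex K -> in_chains K p.+1 c -> in_chains K p (boundary c).
Proof.
move=> [_ closedK] cK s /boundary_neq0[s0 [v vs /cK[vsK]]].
rewrite /dim_cell cardsU1 vs eqSS => dim_s; split=> //.
by apply: closedK vsK _ s0; apply: finset.subsetUr.
Qed.

Lemma in_chainsW K L p c : K \subset L -> in_chains K p c -> in_chains L p c.
Proof. by move=> /fintype.subsetP sKL cK s /cK[/sKL]. Qed.

Lemma in_chains_notin K p c s : in_chains K p c -> s \notin K -> c s = 0.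
Proof.
by move=> cK; apply: contraNeq => /cK[].
Qed.

Lemma in_chains_dim K p c s : in_chains K p c -> ~~ dim_cell p s -> c s = 0.
Proof. by move=> cK; apply: contraNeq => /cK[]. Qed.

Lemma in_chains0 K p : in_chains K p 0.
Proof. by move=> s; rewrite chain0 eqxx. Qed.

Lemma in_chainsB K p c d :
  in_chains K p c -> in_chains K p d -> in_chains K p (c - d).
Proof.
move=> cK dK s; rewrite chainB; have [->|/cK//] := eqVneq (c s) 0.
by rewrite sub0r oppr_eq0 => /dK.
Qed.

Lemma in_chainsD K p c d :
  in_chains K p c -> in_chains K p d -> in_chains K p (c + d).
Proof.
move=> cK dK s; rewrite chainD; have [->|/cK//] := eqVneq (c s) 0.
by rewrite add0r => /dK.
Qed.

Lemma in_chainsMz K p c m : in_chains K p c -> in_chains K p (c *~ m).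
Proof.
by move=> cK s; rewrite chainMz mulf_eq0 => /norP[/cK].
Qed.

Lemma in_chains_sum K p (I : finType) (F : I -> chain V) :
  (forall i, in_chains K p (F i)) -> in_chains K p (\sum_i F i).
Proof.
move=> FK; elim/big_ind: _ => //; [exact: in_chains0 | exact: in_chainsD].
Qed.

Lemma supported_on_set0 c : supported_on set0 c <-> c = 0.
Proof.
split=> [c0|-> s]; last by rewrite chain0 eqxx.
by apply/ffunP=> s; rewrite chain0; apply/eqP/negPn/negP=> /c0; rewrite inE.
Qed.

Lemma supported_onB B c d :
  supported_on B c -> supported_on B d -> supported_on B (c - d).
Proof.
move=> cB dB s; rewrite chainB; have [->|/cB//] := eqVneq (c s) 0.
by rewrite sub0r oppr_eq0 => /dB.
Qed.

Lemma supported_onMz B c m : supported_on B c -> supported_on B (c *~ m).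
Proof. by move=> cB s; rewrite chainMz mulf_eq0 => /norP[/cB]. Qed.

(* One step of fraction-free Gaussian elimination; P is the set of
   combinations regarded as trivial. *)
Lemma eliminate (P : chain V -> Prop) r (z : 'I_r.+1 -> chain V) s :
    (forall a : 'I_r.+1 -> int,
       P (\sum_i z i *~ a i) -> forall i, a i = 0) ->
  exists (j : 'I_r.+1) (m : int) (e : 'I_r -> int),
    let z' i := z (lift j i) *~ m - z j *~ e i in
    (forall i, z' i s = 0) /\
    forall a : 'I_r -> int, P (\sum_i z' i *~ a i) -> forall i, a i = 0.
Proof.
move=> indep_z.
have [j [m [e [m0 z's]]]] : exists (j : 'I_r.+1) (m : int) (e : 'I_r -> int),
    m != 0 /\ forall i, (z (lift j i) *~ m - z j *~ e i) s = 0.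
  (* Any chain nonzero at [s] serves as pivot; if there is none, the first one is dropped and the
     others are kept as they are. *)
  have [/existsP[j zj]|/existsPn z0] := boolP [exists j, z j s != 0].
    exists j, (z j s), (fun i => z (lift j i) s); split=> // i.
    by rewrite !chainE mulrC subrr.
  exists ord0, 1, (fun=> 0); split=> // i.
  by have /negPn/eqP zi := z0 (lift ord0 i); rewrite !chainE zi !mulr0 mul0r.
exists j, m, e; split=> // a triv_a i.
(* These are the coefficients, over the original family, of the combination of the reduced one; the
   entry at [lift j i] is [m * a i] with [m] nonzero. *)
pose b k := if unlift j k is Some i then m * a i else - \sum_i e i * a i.
have /indep_z/(_ (lift j i)) : P (\sum_k z k *~ b k).
  move: triv_a; congr P; apply/ffunP=> t; rewrite !chain_sum (bigD1_ord j) //=.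
  rewrite chainMz /b unlift_none mulrN mulr_sumr -sumrN -big_split /=.
  by apply: eq_bigr => i0 _; rewrite liftK !chainE; ring.
by rewrite /b liftK => /eqP; rewrite mulf_eq0 (negPf m0) => /eqP.
Qed.

(** * Independent families and the rank of homology *)

(** By induction on the size of [A]: eliminating the coefficient at one cell costs one chain and
    removes that cell from the supports. *)
Lemma free_supported_leq A r (z : 'I_r -> chain V) :
    (forall i, supported_on A (z i)) ->
    (forall a : 'I_r -> int, \sum_i z i *~ a i = 0 -> forall i, a i = 0) ->
  (r <= #|A|)%N.
Proof.
have [m] := ubnP #|A|; elim: m => // m IHm in A r z *.
case: r z => // r z ltAm zA freez.
have [A0|[s sA]] := set_0Vmem A.
  have z0 i : z i = 0 by apply/supported_on_set0; rewrite -A0.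
  suff /eqP : (1 : int) = 0 by rewrite oner_eq0.
  by apply: (freez (fun=> 1)) ord0; rewrite big1 // => i _; rewrite z0 mul0rz.
have [j [c [e [z's freez']]]] := @eliminate (fun c => c = 0) _ z s freez.
rewrite (cardsD1 s) sA ltnS; move: ltAm; rewrite (cardsD1 s) sA => ltAm.
apply: IHm ltAm _ freez' => i t tz'; rewrite !inE.
apply/andP; split; first by apply: contraNneq tz' => ->; rewrite z's.
by move: t tz'; apply: supported_onB; apply: supported_onMz.
Qed.

(** The zero chain is a relative boundary, so independent classes have independent representatives
    in the chains of [A]. Hence the bound on [r] in [rank_homology] excludes no family. *)
Lemma homology_independent_leq A B p r (z : 'I_r -> chain V) :
  homology_independent A B p z -> (r <= #|A|)%N.
Proof.
move=> [zA freez]; apply: (@free_supported_leq _ _ z) => [i s|a za0].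
  by have [ziA _] := zA i => /ziA[].
apply: freez; exists 0; split; first exact: in_chains0.
by rewrite boundary0 subr0 za0 => s; rewrite chain0 eqxx.
Qed.

Lemma rank_homology_leq A B p r (z : 'I_r -> chain V) :
  homology_independent A B p z -> (r <= rank_homology A B p)%N.
Proof.
move=> indep_z; have ltr := homology_independent_leq indep_z.
pose F (i : 'I_#|A|.+1) := i : nat.
apply: (@leq_bigmax_cond _ _ F (Ordinal (ltr : r < #|A|.+1)%N)).
by apply/asboolP; exists z.
Qed.

Lemma rank_homology_attained A B p :
  exists z : 'I_(rank_homology A B p) -> chain V, homology_independent A B p z.
Proof.
have : (0 < #|[pred r : 'I_#|A|.+1 |
    `[< exists z, @homology_independent V A B p r z >]]|)%N.
  (* The empty family is independent, so the maximum is over a nonempty set and is attained. *)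
  apply/card_gt0P; exists ord0; apply/asboolP; exists (fun=> 0).
  by split=> [[]|a _ []].
rewrite /rank_homology => /(eq_bigmax_cond (fun i : 'I_#|A|.+1 => i : nat))[r].
by rewrite inE => /asboolP ex_z ->.
Qed.

Lemma in_combination A B p r (z : 'I_r -> chain V) (a : 'I_r -> int) :
  homology_independent A B p z -> in_chains A p (\sum_i z i *~ a i).
Proof.
by move=> [zA _]; apply: in_chains_sum => i; apply: in_chainsMz; case: (zA i).
Qed.

(** * Chain retractions and invariance under collapse *)

(** Independence passes both ways. Since [z - rho z] bounds in [K], applying [rho] keeps a family of
    [K] independent in [L]; and a family of [L] stays independent in [K], because [rho] turns a
    chain bounding in [K] into one of [L]. *)
Lemma betti_retraction K L p (rho : chain V -> chain V) :
    zmod_morphism rho -> L \subset K ->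
    (forall q c, in_chains K q c -> in_chains L q (rho c)) ->
    (forall q c, in_chains K q c -> boundary (rho c) = rho (boundary c)) ->
    (forall q c, in_chains L q c -> rho c = c) ->
    (forall z, in_chains K p z -> boundary z = 0 ->
       rel_boundary K set0 p (z - rho z)) ->
  betti K p = betti L p.
Proof.
move=> rho_add subLK rhoKL rhoB rhoL rhoH.
pose rho' : {additive chain V -> chain V} :=
  HB.pack rho (GRing.isZmodMorphism.Build _ _ rho rho_add).
have rho0 : rho 0 = 0 by apply: (raddf0 rho').
have rho_lin r (z : 'I_r -> chain V) (a : 'I_r -> int) :
    rho (\sum_i z i *~ a i) = \sum_i rho (z i) *~ a i.
  rewrite -[LHS]/(rho' _) raddf_sum; apply: eq_bigr => i _.
  by rewrite [LHS]raddfMz.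
apply/eqP; rewrite eqn_leq.
apply/andP; split; rewrite /betti.
  have [z indep_z] := rank_homology_attained K set0 p.
  have [zK freez] := indep_z.
  apply: (@rank_homology_leq _ _ _ _ (rho \o z)); split=> [i|a].
    have [zi /supported_on_set0 bzi] := zK i; split; first exact: rhoKL.
    by apply/supported_on_set0; rewrite /= (rhoB _ _ zi) bzi rho0.
  move=> [d [dL /supported_on_set0/subr0_eq bd]]; apply: freez.
  set c := \sum_i z i *~ a i.
  have cK : in_chains K p c by apply: in_combination indep_z.
  have rho_c : rho c = boundary d.
    by rewrite rho_lin -bd.
  have [|e [eK /supported_on_set0/subr0_eq be]] := rhoH c cK.
    rewrite boundary_sum big1 // => i _; rewrite boundaryMz.
    by have [_ /supported_on_set0 bzi] := zK i; rewrite bzi mul0rz.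
  (* [e] bounds the difference between [c] and [rho c], and [d] bounds [rho c]. *)
  exists (e + d); split; first by apply: in_chainsD eK (in_chainsW subLK dL).
  by apply/supported_on_set0; rewrite boundaryD -be -rho_c subrK subrr.
have [z indep_z] := rank_homology_attained L set0 p; have [zL freez] := indep_z.
apply: (@rank_homology_leq _ _ _ _ z); split=> [i|a].
  by have [zi bzi] := zL i; split=> //; apply: (in_chainsW subLK).
move=> [d [dK /supported_on_set0/subr0_eq bd]]; apply: freez.
exists (rho d); split; first exact: rhoKL.
apply/supported_on_set0; rewrite (rhoB _ _ dK) -bd (rhoL p) ?subrr //.
exact: in_combination indep_z.
Qed.

Definition single t : chain V := [ffun s => (s == t)%:R].

Lemma singleE t s : single t s = (s == t)%:R. Proof. exact: ffunE. Qed.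

Lemma in_chains_single K p t :
  t \in K -> dim_cell p t -> in_chains K p (single t).
Proof.
by move=> tK dim_t s; rewrite singleE; have [->|_] := eqVneq s t; rewrite ?eqxx.
Qed.

(** Freeness of [s] speaks of cofaces of codimension one only. Any vertex [v] of [u] outside [s]
    gives such a coface [v |: s], which must be [t]; so [u] lies between [s] and [t]. *)
Lemma collapse_pair_coface K s t u : is_complex K -> collapse_pair K s t ->
  u \in K -> s \subset u -> u \in [set s; t].
Proof.
move=> [_ closedK] [_ _ /andP[sub_st /eqP card_t] uniq_t] uK sub_su.
have sub_ut : u \subset t.
  apply/fintype.subsetP => v vu.
  have [/(fintype.subsetP sub_st)//|vs] := boolP (v \in s).
  have <- : v |: s = t; last by rewrite setU11.
  apply: uniq_t; last by apply/facetP; exists v.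
  apply: closedK uK _ _; first by rewrite finset.subUset finset.sub1set vu.
  by apply/set0Pn; exists v; rewrite setU11.
have := subset_leq_card sub_ut; rewrite card_t leq_eqVlt ltnS !inE.
case/orP=> [/eqP card_u|le_us]; apply/orP.
  by right; rewrite eqEcard sub_ut card_t card_u ltnSn.
by left; rewrite eq_sym eqEcard sub_su.
Qed.

Lemma collapse_pair_neq0 K s t :
  is_complex K -> collapse_pair K s t -> s != set0.
Proof. by move=> [K0 _] [sK _ _ _]; apply: contraNneq K0 => <-. Qed.

Lemma collapse_complex K s t : is_complex K -> collapse_pair K s t ->
  is_complex (K :\: [set s; t]).
Proof.
move=> complexK pair_st; have [K0 closedK] := complexK.
have [_ _ /andP[sub_st _] _] := pair_st.
split=> [|u w]; first by rewrite inE (negPf K0) andbF.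
rewrite finset.in_setD => /andP[u_st uK] sub_wu w0.
rewrite finset.in_setD (closedK u) // andbT.
apply: contra u_st => w_st; apply: (collapse_pair_coface complexK pair_st uK).
apply: fintype.subset_trans sub_wu.
by move: w_st; rewrite !inE => /orP[]/eqP->.
Qed.

Lemma collapses_sub K L : collapses K L -> L \subset K.
Proof.
elim=> // {}K {}L s t _ _ sub_L; apply: fintype.subset_trans sub_L _.
exact: finset.subsetDl.
Qed.

(** Only [t] contributes to the boundary at [s]; [e] is the incidence sign of [s] in [t]. *)
Lemma free_face_boundary K s t : is_complex K -> collapse_pair K s t ->
  exists2 e : int, e * e = 1 &
    forall p c, in_chains K p c -> boundary c s = e * c t.
Proof.
move=> complexK pair_st; have s0 := collapse_pair_neq0 complexK pair_st.
have [_ _ /facetP[v vs def_t] uniq_t] := pair_st.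
exists ((-1) ^+ #|[set w in s | (enum_rank w < enum_rank v)%N]|).
  by rewrite -expr2 sqrr_sign.
move=> p c cK; rewrite ffunE (bigD1 v) /= ?s0 // -def_t big1 ?addr0 // => w.
case/andP=> ws neq_wv; suff -> : c (w |: s) = 0 by rewrite mulr0.
apply: (in_chains_notin cK); apply: contra neq_wv => wsK.
have : w \in v |: s.
  by rewrite -def_t -(uniq_t _ wsK) ?setU11 //; apply/facetP; exists w.
by rewrite !inE (negPf ws) orbF.
Qed.

(** Subtracting the boundary of a multiple of [t] clears the coefficient at [s], and the coefficient
    at [t] is then dropped. This is a chain retraction onto the smaller complex. *)
Lemma betti_collapse K s t p : is_complex K -> collapse_pair K s t ->
  betti K p = betti (K :\: [set s; t]) p.
Proof.
move=> complexK pair_st.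
have [e ee1 bdE] := free_face_boundary complexK pair_st.
have [sK tK facet_st uniq_t] := pair_st.
have neq_st : s != t.
  by apply/eqP=> e0; move: facet_st; rewrite /facet e0 ltn_eqF ?andbF.
have dim_st q : dim_cell q.+1 t = dim_cell q s.
  by rewrite /dim_cell; case/andP: facet_st => _ /eqP->.
(* h is a chain homotopy from the identity to the retraction rho: since
   boundary c s = e * c t, the last term of rho c is h (boundary c). *)
pose h c := single t *~ (e * c s).
pose rho c : chain V := c - boundary (h c) - single t *~ c t.
have hB c d : h (c - d) = h c - h d by rewrite /h chainB mulrBr mulrzBr.
have hK q c : in_chains K q c -> in_chains K q.+1 (h c).
  rewrite /h => cK; have [dim_s|/(in_chains_dim cK)->] := boolP (dim_cell q s).
    by apply/in_chainsMz/in_chains_single; rewrite ?dim_st.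
  by rewrite mulr0 mulr0z; apply: in_chains0.
have tK_c q c : in_chains K q c -> in_chains K q (single t *~ c t).
  move=> cK; have [dim_t|/(in_chains_dim cK)->] := boolP (dim_cell q t).
    exact/in_chainsMz/in_chains_single.
  by rewrite mulr0z; apply: in_chains0.
(* A coface of [t] also contains [s], so it would be [s] or [t]; hence [t] is maximal. *)
have bd_t q c : in_chains K q c -> boundary c t = 0.
  move=> cK; apply/eqP/negPn/negP => /boundary_neq0[t0 [v vt /cK[vtK _]]].
  have sub_s : s \subset v |: t.
    case/andP: facet_st => /fintype.subset_trans-> //.
    exact: finset.subsetUr.
  have := collapse_pair_coface complexK pair_st vtK sub_s.
  rewrite !inE => /orP[]/eqP def_u; last by rewrite -def_u setU11 in vt.
  case/andP: facet_st => _.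
  by rewrite -def_u cardsU1 vt add1n ltn_eqF // ltnS leqnSn.
apply: (@betti_retraction _ _ _ rho).
- move=> c d; apply/ffunP=> u; rewrite /rho hB boundaryB !chainE; ring.
- exact: finset.subsetDl.
- move=> q c cK u; have rhoK : in_chains K q (rho c).
    apply: in_chainsB; last exact: tK_c.
    by apply: in_chainsB => //; apply: boundary_in_chains => //; apply: hK.
  move=> nz; have [uK dim_u] := rhoK u nz; split=> //; rewrite !inE uK andbT.
  apply: contraNN nz => /orP[]/eqP->; rewrite /rho !chainE singleE.
    rewrite (bdE _ _ (hK _ _ cK)) chainMz singleE eqxx mul1r mulrA ee1 mul1r.
    by rewrite (negPf neq_st) mul0r subr0 subrr.
  by rewrite (bd_t _ _ (hK _ _ cK)) eqxx mul1r subr0 subrr.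
- move=> q c cK; rewrite /rho !boundaryB boundaryK subr0 boundaryMz /h.
  rewrite (bdE _ _ cK) (bd_t _ _ cK) mulrA ee1 mul1r mulr0z subr0.
  by rewrite boundaryMz.
- move=> q c cL; rewrite /rho /h !(in_chains_notin cL) ?inE ?eqxx ?orbT //.
  by rewrite mulr0 mulr0z boundary0 !subr0.
move=> z zK bz0; exists (h z); split; first exact: hK.
(* On a cycle the boundary coefficient [e * z t] at [s] is zero, so [z - rho z] is just the boundary
   of [h z]. *)
have zt : z t = 0.
  have := bdE _ _ zK; rewrite bz0 chain0 => /esym/(congr1 ( *%R e)).
  by rewrite mulrA ee1 mul1r mulr0.
apply/supported_on_set0.
by rewrite /rho zt mulr0z subr0 opprB addrCA subrr addr0 subrr.
Qed.

(** * Adding a top-dimensional cell *)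

Lemma in_chainsD1 K p c s :
  in_chains K p c -> c s = 0 -> in_chains (K :\ s) p c.
Proof.
move=> cK cs t ct; have [tK dim_t] := cK t ct; split=> //.
by rewrite !inE tK andbT; apply: contraNneq ct => ->; rewrite cs.
Qed.

(** Because [K :\ s] is closed under faces, no other cell of [K] has [s] as a face. *)
Lemma maximal_boundary K s p c :
  is_complex (K :\ s) -> in_chains K p c -> boundary c s = 0.
Proof.
move=> [_ closedK] cK; apply/eqP/negPn/negP.
case/boundary_neq0=> s0 [v vs /cK[vsK _]].
have := closedK (v |: s) s; rewrite !inE eqxx /= vsK andbT finset.subsetUr s0.
move=> abs; suff: false by []; apply: abs => //.
by apply: contraNneq vs => <-; rewrite setU11.
Qed.

(** Subtracting a multiple of the cycle [o], whose coefficient at [s] is a unit, retracts chains of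
    [K] onto [K :\ s]. Outside degree [n] nothing changes; in degree [n] the class of [o] is the one
    that is added. *)
Lemma betti_top_cell K s n p (o : chain V) :
    is_complex (K :\ s) -> dim_cell n s -> in_chains K n o -> boundary o = 0 ->
    o s * o s = 1 ->
  betti K p = (betti (K :\ s) p + (p == n))%N.
Proof.
move=> complexL dim_s oK bo0 oo1; set L := K :\ s.
have sub_LK : L \subset K by apply: subD1set.
pose rho c : chain V := c - o *~ (o s * c s).
have rho_dim q c : q != n -> in_chains K q c -> rho c = c.
  move=> neq_qn /in_chains_dim cs; rewrite /rho cs ?mulr0 ?mulr0z ?subr0 //.
  by rewrite /dim_cell (eqP dim_s) eqSS eq_sym.
have rho_s c : rho c s = 0 by rewrite /rho !chainE mulrA oo1 mul1r subrr.
have rhoK q c : in_chains K q c -> in_chains L q (rho c).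
  move=> cK; apply: in_chainsD1 => //; have [e|/rho_dim->//] := eqVneq q n.
  by apply: in_chainsB => //; apply: in_chainsMz; rewrite e.
have rhoL q c : in_chains L q c -> rho c = c.
  move=> cL; rewrite /rho (in_chains_notin cL) ?inE ?eqxx //.
  by rewrite mulr0 mulr0z subr0.
have rhoB q c : in_chains K q c -> boundary (rho c) = rho (boundary c).
  move=> cK; rewrite /rho boundaryB boundaryMz bo0 mul0rz.
  by rewrite (maximal_boundary complexL cK) mulr0 mulr0z.
have rho_add : zmod_morphism rho.
  by move=> c d; apply/ffunP=> u; rewrite /rho !chainE; ring.
have [e|neq_pn] := eqVneq p n; last first.
  rewrite addn0; apply: (betti_retraction rho_add) rhoK rhoB rhoL _ => //.
  move=> z zK _; exists 0; split; first exact: in_chains0.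
  by rewrite (rho_dim _ _ neq_pn zK) boundary0 !subrr; apply/supported_on_set0.
rewrite e addn1; apply/eqP; rewrite eqn_leq; apply/andP; split.
  (* Upper bound: eliminating the coefficient at [s] costs one class and puts the others in [L]. *)
  rewrite {1}/betti; have [] := rank_homology_attained K set0 n.
  case: (rank_homology K set0 n) => // r z [zK freez].
  have [j [m [a [z's freez']]]] :=
    @eliminate (rel_boundary K set0 n) _ z s freez.
  rewrite ltnS.
  apply: (@rank_homology_leq _ _ _ _ (fun i => z (lift j i) *~ m - z j *~ a i)).
  split=> [i|b].
    split.
      apply: in_chainsD1; last exact: z's.
      by apply: in_chainsB; apply: in_chainsMz; apply: (zK _).1.
    rewrite boundaryB !boundaryMz; apply: supported_onB; apply: supported_onMz.
      by case: (zK (lift j i)).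
    by case: (zK j).
  case=> d [dL bd]; apply: freez'; exists d; split=> //.
  exact: in_chainsW dL.
(* Lower bound: an independent family of [L] is enlarged by [o], placed at the last index. *)
have [z indep_z] := rank_homology_attained L set0 n; have [zL freez] := indep_z.
pose y (i : 'I_(rank_homology L set0 n).+1) := oapp z o (unlift ord_max i).
apply: (@rank_homology_leq _ _ _ _ y); split=> [i|a].
  rewrite /y; case: unliftP => [j _|_] /=.
    by have [zj bzj] := zL j; split=> //; apply: in_chainsW zj.
  by split=> //; apply/supported_on_set0.
case=> d [dK /supported_on_set0/subr0_eq].
rewrite (bigD1_ord ord_max) //= /y unlift_none /=.
under eq_bigr do rewrite liftK /=.
set c := \sum_i _ => bd; have cL : in_chains L n c.
  by apply: in_chains_sum => i; apply: in_chainsMz; case: (zL i).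
(* At the maximal cell [s] boundaries vanish, and so does [c], which lies in [L]; only the multiple
   of [o] is left. *)
have a0 : a ord_max = 0.
  have := maximal_boundary complexL dK.
  rewrite -bd chainD chainMz (in_chains_notin cL).
    by rewrite addr0 => /(congr1 ( *%R (o s))); rewrite mulrA oo1 mul1r mulr0.
  by rewrite !inE eqxx.
move: bd; rewrite a0 mulr0z add0r => bd i.
case: (unliftP ord_max i) => [j ->|-> //]; apply: (freez (a \o lift ord_max)).
exists (rho d); split; first exact: rhoK.
by apply/supported_on_set0; rewrite (rhoB _ _ dK) -bd (rhoL n) ?subrr.
Qed.

(** This is the homology of a closed cell modulo its boundary sphere. A relative chain counts only
    through its coefficient at [s], since a chain of the closure vanishing there is supported on
    [Ex] and is trivial. *)
Lemma rank_homology_cell K s n p : is_complex K -> s \in K -> dim_cell n s ->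
  rank_homology (Cl K [set s]) (Ex K [set s]) p = (p == n).
Proof.
move=> [_ closedK] sK dim_s; set A := Cl K [set s]; set B := Ex K [set s].
have AE t : (t \in A) = (t \in K) && (t \subset s).
  rewrite inE; congr (_ && _); apply/existsP/idP => [[u]|ts].
    by rewrite inE => /andP[/eqP->].
  by exists s; rewrite inE eqxx.
have BE t : (t \in B) = (t \in A) && (t != s) by rewrite !inE andbC.
have trivB q c : in_chains A q c -> c s = 0 -> supported_on B c.
  move=> cA cs t ct; rewrite BE (cA t ct).1.
  by apply: contraNneq ct => ->; rewrite cs.
have trivial_rel q c : supported_on B c -> rel_boundary A B q c.
  move=> cB; exists 0; split; first exact: in_chains0.
  by rewrite boundary0 subr0.
apply/eqP; rewrite eqn_leq; apply/andP; split.
  have [] := rank_homology_attained A B p.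
  case: (rank_homology A B p) => // r z [zA freez].
  have [j [m [a [z's freez']]]] := @eliminate (rel_boundary A B p) _ z s freez.
  case: r => [|r] in z zA freez j a z's freez' *.
    have [//|neq_pn] := eqVneq p n.
    have zs : z ord0 s = 0.
      apply: in_chains_dim (zA ord0).1 _.
      by rewrite /dim_cell (eqP dim_s) eqSS eq_sym.
    suff /eqP : (1 : int) = 0 by rewrite oner_eq0.
    apply: (freez (fun=> 1)) ord0; apply: trivial_rel; rewrite big_ord1.
    by apply: trivB (zA ord0).1 zs.
  (* With two or more classes, at least one survives the elimination at [s]; vanishing there, it is
     trivial, against independence. *)
  suff /eqP : (1 : int) = 0 by rewrite oner_eq0.
  apply: (freez' (fun i => (i == ord0)%:R)) ord0; apply: trivial_rel.
  rewrite (bigD1 ord0) //= big1 ?addr0 => [|i /negPf->]; last by rewrite mulr0z.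
  apply: (trivB p); last by rewrite chainMz z's mul0r.
  by apply: in_chainsMz; apply: in_chainsB; apply: in_chainsMz; apply: (zA _).1.
have [->|//] := eqVneq p n.
have sA : s \in A by rewrite AE sK fintype.subxx.
apply: (@rank_homology_leq _ _ _ _ (fun=> single s)); split=> [i|a].
  split; first exact: in_chains_single.
  move=> t /boundary_neq0[t0 [v vt]]; rewrite singleE.
  have [def_s _|] := eqVneq (v |: t) s; last by rewrite eqxx.
  have sub_ts : t \subset s by rewrite -def_s finset.subsetUr.
  rewrite BE AE sub_ts (closedK s) //=.
  by apply: contraNneq vt => ->; rewrite -def_s setU11.
case=> d [dA bd] i; rewrite [i]ord1; apply/eqP/negPn/negP => ai.
have := bd s; rewrite BE eqxx andbF => bd_s; suff: false by []; apply: bd_s.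
(* The closure of the [n]-cell [s] has no cell of dimension [n.+1]. *)
have d0 : d = 0.
  apply/ffunP=> t; rewrite chain0; apply/eqP/negPn/negP => /dA[].
  rewrite AE => /andP[_ /subset_leq_card]; rewrite /dim_cell (eqP dim_s).
  by move=> le_t /eqP e; rewrite e ltnn in le_t.
by rewrite d0 boundary0 subr0 big_ord1 chainMz singleE eqxx mul1r.
Qed.

End Homology.

(** * Extension by cells of larger value *)

Section Extension.
Variables (R : realType) (V : finType) (k : nat).
Variables (K L : {set {set V}}) (g : {set V} -> 'rV[R]_k).
Implicit Types (s t : {set V}) (C D : {set {set V}}).

(** One plus the sum of all absolute values of coordinates of [g] on [L] strictly exceeds each
    single coordinate. Using the same vector for all new cells makes every facet relation between
    new cells a gradient pair. *)
Definition extension s : 'rV[R]_k :=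
  if s \in L then g s
  else const_mx (1 + \sum_(t in L) \sum_i `|g t 0 i|).
Local Notation f := extension.

Hypothesis k_gt0 : (0 < k)%N.
Hypothesis complexK : is_complex K.
Hypothesis complexL : is_complex L.
Hypothesis sub_LK : L \subset K.
(** In dimension zero [preceq] would hold vacuously; this coordinate witnesses its failure from a
    new value down to an old one. *)
Let i0 : 'I_k := Ordinal k_gt0.

Lemma extensionE s : s \in L -> f s = g s.
Proof. by rewrite /f => ->. Qed.

Lemma extension_lt s t i : s \in L -> t \notin L -> f s 0 i < f t 0 i.
Proof.
move=> sL tL; rewrite /f sL (negPf tL) mxE; apply: le_lt_trans (ler_norm _) _.
rewrite (bigD1 s) //= (bigD1 i) //= -addrA [ltRHS]addrCA ltrDl.
apply: ltr_wpDr => //.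
by apply: addr_ge0; apply: sumr_ge0 => // t' _; apply: sumr_ge0.
Qed.

Lemma extension_preceq s t :
  s \in L -> t \notin L -> preceq (f t) (f s) = false.
Proof.
by move=> sL tL; apply/forallP => /(_ i0); rewrite leNgt extension_lt.
Qed.

Lemma extension_prec s t : s \in L -> t \notin L -> prec (f s) (f t).
Proof.
move=> sL tL; apply/andP; split.
  by apply/forallP => i; apply/ltW/extension_lt.
by apply: contraTneq (extension_lt i0 sL tL) => ->; rewrite ltxx.
Qed.

Lemma face_in s t : s \in K -> t \in L -> s \subset t -> s \in L.
Proof.
move=> sK tL sub_st; apply: complexL.2 tL sub_st _.
by apply: contraNneq complexK.1 => <-.
Qed.

Lemma facet_in s t : s \in K -> t \in L -> facet s t -> s \in L.
Proof. by move=> sK tL /andP[+ _]; apply: face_in. Qed.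

(** * Gradient pairs of the extension and the MDM conditions *)

Lemma extension_Hset s : s \in L -> Hset K f s = Hset L g s.
Proof.
move=> sL; apply/setP=> b; rewrite !inE.
have [bL|bL] := boolP (b \in L).
  by rewrite (fintype.subsetP sub_LK) // !extensionE.
by rewrite extension_preceq // !andbF.
Qed.

Lemma extension_Tset s : s \in L -> Tset K f s = Tset L g s.
Proof.
move=> sL; apply/setP=> a; rewrite !inE.
have [aL|aL] := boolP (a \in L).
  by rewrite (fintype.subsetP sub_LK) // !extensionE.
by apply/negP => /and3P[aK /(facet_in aK sL)]; rewrite (negPf aL).
Qed.

Lemma preceq_refl (a : 'rV[R]_k) : preceq a a.
Proof. exact/forallP. Qed.

Lemma extension_new s t : s \notin L -> t \notin L -> f s = f t.
Proof. by rewrite /f => /negPf-> /negPf->. Qed.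

Lemma extension_Hset_new s : s \in K -> s \notin L ->
  Hset K f s = [set b in K :\: L | facet s b].
Proof.
move=> sK sL; apply/setP=> b; rewrite !inE.
have [bK|//] := boolP (b \in K); last by rewrite andbF.
have [bL|bL] /= := boolP (b \in L).
  by apply/negP => /andP[/(facet_in sK bL)]; rewrite (negPf sL).
by rewrite (extension_new bL sL) preceq_refl andbT.
Qed.

Lemma extension_Tset_new s : s \notin L ->
  Tset K f s = [set a in K :\: L | facet a s].
Proof.
move=> sL; apply/setP=> a; rewrite !inE.
have [aK|//] := boolP (a \in K); last by rewrite andbF.
have [aL|aL] /= := boolP (a \in L); first by rewrite extension_preceq ?andbF.
by rewrite (extension_new aL sL) preceq_refl andbT.
Qed.

Lemma facet_irrefl s : facet s s = false.
Proof. by rewrite /facet ltn_eqF ?andbF. Qed.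

(** The sets [Hset] and [Tset] of a new cell consist of new cells other than itself, so two new
    cells leave room for at most one element. Between old and new cells the new value is always
    strictly larger. *)
Lemma extension_mdm : (#|K :\: L| <= 2)%N -> is_mdm L g -> is_mdm K f.
Proof.
move=> card2 mdm_g s sK; have [sL|sL] := boolP (s \in L).
  have [H1 T1 H2 T2] := mdm_g s sL.
  rewrite extension_Hset // extension_Tset //; split=> // t tK facet_t.
    have [tL|tL _] := boolP (t \in L); last exact: extension_prec.
    by rewrite !extensionE //; apply: H2.
  by have tL := facet_in tK sL facet_t; rewrite !extensionE //; apply: T2.
have sKL : s \in K :\: L by rewrite inE sL.
have le1 (A : {set {set V}}) : A \subset K :\: L -> s \notin A -> (#|A| <= 1)%N.
  move=> sub_A sA; rewrite -ltnS; apply: leq_trans _ card2.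
  by apply: proper_card; apply/properP; split=> //; exists s.
rewrite extension_Hset_new // extension_Tset_new //; split.
- apply: le1; last by rewrite inE facet_irrefl andbF.
  by apply/fintype.subsetP => t; rewrite inE => /andP[].
- apply: le1; last by rewrite inE facet_irrefl andbF.
  by apply/fintype.subsetP => t; rewrite inE => /andP[].
- move=> b bK facet_b; rewrite !inE facet_b bK !andbT negbK => bL.
  by case/negP: sL; apply: facet_in facet_b.
move=> a aK facet_a; rewrite !inE facet_a aK !andbT negbK => aL.
exact: extension_prec.
Qed.

(** * Critical cells and gradient paths *)

Lemma extension_critical :
  critical K f = critical L g :|: (critical K f :\: L).
Proof.
apply/setP=> s; rewrite [RHS]inE [_ \in _ :\: _]inE.
have [sL|sL] := boolP (s \in L); last first.
  by rewrite ![_ \in critical L _]inE (negPf sL).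
rewrite orbF !inE (fintype.subsetP sub_LK) //.
by rewrite extension_Hset ?extension_Tset // sL.
Qed.

Lemma extension_critical_in s :
  s \in L -> (s \in critical K f) = (s \in critical L g).
Proof. by move=> sL; rewrite extension_critical !inE sL orbF. Qed.

(** No gradient pair leads out of [L], because values only go down along it. Hence paths that start
    in [L] stay there. *)
Lemma extension_gvf s t : s \in L -> gvf K f s t = gvf L g s t.
Proof.
move=> sL; rewrite /gvf; have [tL|tL] := boolP (t \in L).
  by rewrite sL !(fintype.subsetP sub_LK) // !extensionE.
by rewrite extension_preceq // !andbF.
Qed.

Lemma gvf_dom (h : {set V} -> 'rV[R]_k) s t : gvf L h s t -> t \in L.
Proof. by case/and4P. Qed.

Lemma extension_vstep s t : s \in L -> vstep K f s t = vstep L g s t.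
Proof.
move=> sL; apply/existsP/existsP => -[u /and3P[gvf_su tK tu]]; exists u.
  move: gvf_su; rewrite extension_gvf // => gvf_su; rewrite gvf_su tu andbT /=.
  exact: face_in tK (gvf_dom gvf_su) (proper_sub tu).
by rewrite extension_gvf // gvf_su tu andbT (fintype.subsetP sub_LK).
Qed.

Lemma vstep_dom (h : {set V} -> 'rV[R]_k) s t : vstep L h s t -> t \in L.
Proof. by case/existsP=> u /and3P[]. Qed.

Lemma connect_vstep_dom s t : s \in L -> connect (vstep L g) s t -> t \in L.
Proof.
move=> sL /connectP[p + ->]; elim: p s sL => //= u p IHp s sL.
by case/andP=> /vstep_dom uL; apply: IHp.
Qed.

Lemma extension_connect s t : s \in L ->
  connect (vstep K f) s t = connect (vstep L g) s t.
Proof.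
move=> sL; apply/connectP/connectP => -[p path_p ->]; exists p => //.
  elim: p s sL path_p => //= u p IHp s sL; rewrite extension_vstep //.
  by case/andP=> su; rewrite su; apply: IHp; apply: vstep_dom su.
elim: p s sL path_p => //= u p IHp s sL; rewrite extension_vstep //.
by case/andP=> su; rewrite su; apply: IHp; apply: vstep_dom su.
Qed.

Lemma reach_dom a b : reach L g a b -> b \in L.
Proof.
case/existsP=> s0 /andP[s0L /existsP[s /andP[sL /and3P[_ _]]]].
by case/orP=> [/eqP->|/gvf_dom].
Qed.

Lemma extension_reach a b : a \in L -> reach K f a b = reach L g a b.
Proof.
move=> aL; apply/existsP/existsP => -[s0 /andP[s0K /existsP[s /andP[sK]]]].
  case/and3P=> sub_s0a; have s0L := face_in s0K aL sub_s0a.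
  rewrite extension_connect // => s0s; have sL := connect_vstep_dom s0L s0s.
  rewrite extension_gvf // => sb; exists s0; rewrite s0L.
  by apply/existsP; exists s; rewrite sL sub_s0a s0s.
case/and3P=> sub_s0a s0s sb; exists s0; rewrite (fintype.subsetP sub_LK) //=.
apply/existsP; exists s; rewrite (fintype.subsetP sub_LK) // sub_s0a.
by rewrite extension_connect // s0s extension_gvf.
Qed.

(** * Links, critical components and acyclicity *)

Lemma extension_link s t : s \in L -> link K f s t = link L g s t.
Proof.
move=> sL; rewrite /link extension_reach // extension_critical_in //.
have [st|] := boolP (reach L g s t); last by rewrite !andbF.
have tL := reach_dom st.
by rewrite extension_critical_in // !extensionE.
Qed.

(** A link needs a coordinate on which the values agree, and old and new values differ in every
    coordinate. *)
Lemma extension_link_new s t : s \notin L -> link K f s t -> t \notin L.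
Proof.
move=> sL /and4P[_ _ _ /existsP[i /eqP fst]]; apply/negP => tL.
by have := extension_lt i tL sL; rewrite fst ltxx.
Qed.

Lemma link_in (h : {set V} -> 'rV[R]_k) s t :
  link L h s t -> s \in L /\ t \in L.
Proof. by case/and4P; rewrite !inE => /andP[-> _] /andP[-> _]. Qed.

(** Each stage creates at most one critical cell: none for a collapse pair, one for the top cell.
    Two of them would share their value and could be linked. *)
Hypothesis unique_new : forall s t,
  s \in critical K f :\: L -> t \in critical K f :\: L -> s = t.

(** Any link of [f] that is not one of [g] joins the new critical cell to itself. *)
Lemma extension_link_equiv : link_equiv K f =2 link_equiv L g.
Proof.
have link_or s t : link K f s t -> link L g s t \/ s = t.
  move=> st; have [sL|sL] := boolP (s \in L).
    by left; rewrite -extension_link.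
  right; have tL := extension_link_new sL st.
  by case/and4P: st => sC tC _ _; apply: unique_new; rewrite inE ?sL ?tL.
have link_sub s t : link L g s t -> link K f s t.
  by move=> st; rewrite extension_link //; case: (link_in st).
move=> s t; apply/idP/idP; apply: connect_sub => {s t} s t /= /orP[]st.
- by case: (link_or _ _ st) => [st'|->]; rewrite ?connect0 // connect1 //= st'.
- by case: (link_or _ _ st) => [st'|->];
    rewrite ?connect0 // connect1 //= st' orbT.
- by rewrite connect1 //= link_sub.
- by rewrite connect1 //= (link_sub _ _ st) orbT.
Qed.

Lemma link_equiv_in s t : s \in L -> link_equiv L g s t -> t \in L.
Proof.
move=> sL /connectP[p + ->]; elim: p s sL => //= u p IHp s sL.
by case/andP=> /orP[]/link_in[uL1 uL2]; apply: IHp.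
Qed.

Lemma link_equiv_new s t : s \notin L -> link_equiv L g s t -> s = t.
Proof.
move=> sL /connectP[[|u p] //= + ->].
by case/andP=> /orP[]/link_in[uL1 uL2] _; rewrite ?uL1 ?uL2 in sL.
Qed.

Lemma critical_in (A : {set {set V}}) (h : {set V} -> 'rV[R]_k) s :
  s \in critical A h -> s \in A.
Proof. by rewrite inE => /andP[]. Qed.

Lemma components_sub C : C \in components L g -> C \subset critical L g.
Proof.
case/imsetP=> s sC ->; apply/fintype.subsetP => t.
by rewrite inE => /andP[].
Qed.

Lemma extension_components : components K f =
  components L g :|: [set [set s] | s in critical K f :\: L].
Proof.
pose F s := [set t in critical K f | link_equiv K f s t].
transitivity (F @: critical L g :|: F @: (critical K f :\: L)).
  by rewrite -imsetU -extension_critical.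
congr (_ :|: _); apply: eq_in_imset => s sC; apply/setP=> t.
  rewrite [LHS]inE [RHS]inE extension_link_equiv.
  have [st|] := boolP (link_equiv L g s t); last by rewrite !andbF.
  have tL := link_equiv_in (critical_in sC) st.
  by rewrite extension_critical_in.
rewrite [LHS]inE finset.in_set1 extension_link_equiv.
move: sC; rewrite finset.in_setD => /andP[sL sC].
apply/andP/eqP => [[_ /(link_equiv_new sL)]//|->]; split=> //.
exact: connect0.
Qed.

Lemma extension_component_link C D : C \subset L ->
  component_link K f C D = component_link L g C D.
Proof.
move=> CL; apply: eq_existsb => s; have [sC|//] := boolP (s \in C).
congr (_ && _); apply: eq_existsb => t.
by rewrite extension_link // (fintype.subsetP CL).
Qed.

(** A cycle through components of [g] only is a cycle of [g]. Otherwise it meets a new component,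
    from which links lead only back to itself, so all its members coincide. *)
Lemma extension_acyclic : acyclic L g -> acyclic K f.
Proof.
move=> acyc_g c [cC cyc_c [C [D [Cc Dc neq_CD]]]].
have sub_L E : E \in components L g -> E \subset L.
  move=> /components_sub/fintype.subset_trans-> //.
  by apply/fintype.subsetP => s /critical_in.
have [cL|] := boolP (all [in components L g] c).
  apply: (acyc_g c); split; [exact/allP | | by exists C, D].
  move: cyc_c; apply: sub_in_cycle cL => A B AC BC.
  by rewrite extension_component_link ?sub_L.
case/allPn => E Ec EC.
have new_link A B :
    B \in components K f -> A \notin components L g ->
    A \in components K f -> component_link K f A B -> B = A.
  rewrite extension_components => BC AL; rewrite inE (negPf AL) /=.
  case/imsetP=> s sC def_A /existsP[s' /andP[]].
  rewrite def_A inE => /eqP-> /existsP[t /andP[tB st]].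
  have sL : s \notin L by move: sC; rewrite inE => /andP[].
  have tL := extension_link_new sL st; move: BC; rewrite inE => /orP[BL|].
    by case/negP: tL; apply: (fintype.subsetP (sub_L _ BL)).
  by case/imsetP=> t' t'C ->; rewrite (unique_new t'C sC).
(* The cycle is rotated to begin at the new component [E], and equality with [E] then propagates
   along it. *)
have [i c' rot_c] := rot_to Ec.
have {}cyc_c : path (component_link K f) E c'.
  by have := cyc_c; rewrite -(rot_cycle i) rot_c /= rcons_path => /andP[].
have {}cC : {subset E :: c' <= components K f}.
  by move=> A; rewrite -rot_c mem_rot => /cC.
have c'E : all (pred1 E) c'.
  elim: c' cyc_c cC {rot_c} => //= A c' IHc' /andP[EA path_c'] cC.
  have AE : A = E by apply: new_link EA; rewrite ?cC ?inE ?eqxx ?orbT.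
  rewrite AE eqxx IHc' //=; first by rewrite -{1}AE.
  move=> B BE; apply: cC; move: BE.
  by rewrite !inE => /orP[->//|->]; rewrite !orbT.
have allE A : A \in c -> A = E.
  rewrite -(mem_rot i) rot_c inE => /orP[/eqP//|/(allP c'E)/eqP//].
by case: neq_CD; rewrite (allE _ Cc) (allE _ Dc).
Qed.

(** * Morse sets and Conley coefficients *)

(** A cell of the Morse set is reached from a cell of [C], hence from [L], and so lies in [L]
    itself. *)
Lemma extension_morse_set C : C \subset L -> morse_set K f C = morse_set L g C.
Proof.
move=> CL; apply/setP=> b; rewrite ![b \in _]inE.
have subL := fintype.subsetP CL.
apply/andP/andP => -[bK /existsP[t /andP[tC /existsP[t' /and3P[t'C t'b bt]]]]].
  have t'L := subL _ t'C; move: t'b; rewrite extension_reach // => t'b.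
  have bL := reach_dom t'b; move: bt; rewrite extension_reach // => bt.
  split=> //; apply/existsP; exists t; rewrite tC.
  by apply/existsP; exists t'; rewrite t'C t'b.
split; first exact: (fintype.subsetP sub_LK).
apply/existsP; exists t; rewrite tC; apply/existsP; exists t'.
by rewrite t'C !extension_reach ?t'b // subL.
Qed.

Lemma Cl_sub C : C \subset L -> Cl K C = Cl L C.
Proof.
move=> CL; apply/setP=> s; rewrite !inE.
apply/andP/andP => -[sA exC]; split=> //; last exact: (fintype.subsetP sub_LK).
case/existsP: exC => t /andP[tC sub_st].
by apply: face_in sA _ sub_st; apply: (fintype.subsetP CL).
Qed.

Lemma extension_conley C p : C \in components L g ->
  conley K f C p = conley L g C p.
Proof.
move=> Cc; have CL : C \subset L.
  apply: fintype.subset_trans (components_sub Cc) _.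
  by apply/fintype.subsetP => s /critical_in.
have ML : morse_set L g C \subset L.
  by apply/fintype.subsetP => s; rewrite inE => /andP[].
by rewrite /conley /Ex extension_morse_set // Cl_sub.
Qed.

Lemma extension_morse_number p : morse_number K f p =
  (morse_number L g p + \sum_(s in critical K f :\: L) conley K f [set s] p)%N.
Proof.
(* Components of [g] consist of cells of [L], whereas the new singletons lie outside it. *)
have disj : [disjoint components L g & [set [set s] | s in critical K f :\: L]].
  rewrite -setI_eq0; apply/eqP/setP=> C; rewrite in_set0; apply/negP.
  rewrite finset.in_setI => /andP[/components_sub/fintype.subsetP Cg].
  case/imsetP=> s sC def_C.
  have /Cg/critical_in sL : s \in C by rewrite def_C set11.
  by move: sC; rewrite inE sL.
transitivity (\sum_(C in components L g) conley K f C p +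
    \sum_(C in [set [set s] | s in critical K f :\: L]) conley K f C p)%N.
  rewrite -bigU //; apply: eq_bigl => C.
  by rewrite extension_components finset.in_setU.
have inj1 : {in critical K f :\: L &, injective (fun s => [set s])}.
  by move=> s t _ _ /=; apply: finset.set1_inj.
have -> : (\sum_(C in [set [set s] | s in critical K f :\: L]) conley K f C p =
    \sum_(s in critical K f :\: L) conley K f [set s] p)%N by apply: big_imset.
have -> : (\sum_(C in components L g) conley K f C p = morse_number L g p)%N.
  by apply: eq_bigr => C Cg; apply: extension_conley.
by [].
Qed.

End Extension.

(** * From the spine to the manifold *)

Section Spine.
Variables (R : realType) (V : finType) (k : nat).
Hypothesis k_gt0 : (0 < k)%N.
Implicit Types (s t : {set V}) (K L : {set {set V}}) (g : {set V} -> 'rV[R]_k).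

(** The two added cells are paired with each other, so no critical cell appears; Morse numbers and
    Betti numbers both stay the same. *)
Lemma collapse_component_perfect K s t g :
    is_complex K -> collapse_pair K s t ->
    component_perfect (K :\: [set s; t]) g ->
  component_perfect K (extension (K :\: [set s; t]) g).
Proof.
set L := K :\: [set s; t] => complexK pair_st [mdm_g acyc_g perf_g].
have [sK tK facet_st _] := pair_st.
have complexL : is_complex L by apply: collapse_complex.
have sub_LK : L \subset K by apply: finset.subsetDl.
have new_st : K :\: L = [set s; t].
  rewrite setDDr setDv set0U; apply/finset.setIidPr.
  by apply/fintype.subsetP => u; rewrite !inE => /orP[]/eqP->.
have sL : s \notin L by rewrite !inE eqxx.
have tL : t \notin L by rewrite !inE eqxx orbT.
have no_new : critical K (extension L g) :\: L = set0.
  apply/setP=> u; rewrite in_set0; apply/negP; rewrite inE => /andP[uL uC].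
  have : u \in [set s; t] by rewrite -new_st inE uL (critical_in uC).
  move: uC; rewrite inE => /and3P[_ Hu Tu].
  rewrite !inE => /orP[]/eqP e; subst u.
    have : t \in Hset K (extension L g) s.
      by rewrite extension_Hset_new // !inE eqxx orbT tK.
    by rewrite (eqP Hu) inE.
  have : s \in Tset K (extension L g) t.
    by rewrite extension_Tset_new // !inE eqxx sK.
  by rewrite (eqP Tu) inE.
have uniq_new u v : u \in critical K (extension L g) :\: L ->
    v \in critical K (extension L g) :\: L -> u = v by rewrite no_new inE.
split.
- apply: extension_mdm => //; rewrite new_st cards2; by case: eqP.
- exact: extension_acyclic.
move=> p; rewrite extension_morse_number // no_new big_set0 addn0 perf_g.
by rewrite (betti_collapse p complexK pair_st).
Qed.

(** The new cell is critical and is its own Morse set. Its Conley coefficient, one in degree [n],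
    matches the rise of the Betti number caused by the cycle [o]. *)
Lemma top_cell_component_perfect K s n g (o : chain V) :
    is_complex K -> is_complex (K :\ s) -> s \in K -> dim_cell n s ->
    in_chains K n o -> boundary o = 0 -> o s * o s = 1 ->
    component_perfect (K :\ s) g ->
  component_perfect K (extension (K :\ s) g).
Proof.
set L := K :\ s; set f := extension L g.
move=> complexK complexL sK dim_s oK bo0 oo1 [mdm_g acyc_g perf_g].
have sub_LK : L \subset K by apply: subD1set.
have new_s : K :\: L = [set s].
  rewrite setDDr setDv set0U; apply/finset.setIidPr.
  by rewrite finset.sub1set.
have sL : s \notin L by rewrite !inE eqxx.
have no_facet u : u \in K :\: L -> [set v in K :\: L | facet u v] = set0 /\
    [set v in K :\: L | facet v u] = set0.
  rewrite new_s inE => /eqP->; split; apply/setP=> v; rewrite !inE;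
  by case: eqP => // ->; rewrite facet_irrefl.
have [Hs Ts] : Hset K f s = set0 /\ Tset K f s = set0.
  rewrite extension_Hset_new // extension_Tset_new //.
  by apply: no_facet; rewrite new_s set11.
have crit_s : s \in critical K f by rewrite inE sK Hs Ts eqxx.
have crit_new : critical K f :\: L = [set s].
  apply/eqP; rewrite eqEsubset finset.sub1set finset.in_setD sL crit_s !andbT.
  apply/fintype.subsetP => u; rewrite -new_s !finset.in_setD.
  by case/andP=> -> /critical_in.
have uniq_new u v :
    u \in critical K f :\: L -> v \in critical K f :\: L -> u = v.
  by rewrite crit_new !finset.in_set1 => /eqP-> /eqP->.
have max_s u : u \in K -> s \subset u -> u = s.
  move=> uK sub_su; apply/eqP; apply: contraNT sL => neq_us.
  apply: (complexL.2 u) => //; first by rewrite !inE neq_us.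
  by apply: contraNneq complexK.1 => <-.
have morse_s : morse_set K f [set s] = [set s].
  apply/setP=> b; rewrite !finset.in_set1; apply/idP/eqP => [|->]; last first.
    have reach_s : reach K f s s.
      apply/existsP; exists s; rewrite sK; apply/existsP; exists s.
      by rewrite sK fintype.subxx connect0 eqxx.
    rewrite inE sK; apply/existsP; exists s; rewrite set11.
    by apply/existsP; exists s; rewrite set11 reach_s.
  rewrite inE => /andP[bK /existsP[t /andP[]]].
  rewrite inE => /eqP-> /existsP[t' /and3P[_ _]].
  case/existsP=> s0 /andP[s0K /existsP[u /andP[uK /and3P[sub_s0b s0u us]]]].
  (* The last cell [u] of a path to [s] is not paired with [s], because [Tset] of [s] is empty. *)
  have {us} def_u : s = u.
    case/orP: us => [/eqP//|/and4P[_ _ facet_us le_su]].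
    have : u \in Tset K f s by rewrite !inE uK facet_us.
    by rewrite Ts inE.
  (* A step into [s] would make it a proper face of some [w], against maximality. So the path is
     trivial, and [b] contains [s] and equals it. *)
  apply: (max_s _ bK (fintype.subset_trans _ sub_s0b)).
  case/connectP: s0u => p; case/lastP: p => [|p v].
    by move=> _ /= def_s0; rewrite def_u def_s0.
  rewrite rcons_path last_rcons -def_u => /andP[_ /existsP[w]] /[swap] <-.
  case/and3P=> /and4P[_ wK _ _] _ /properP[sub_sw [x xw xs]].
  by rewrite (max_s _ wK sub_sw) (negPf xs) in xw.
split.
- by apply: extension_mdm => //; rewrite new_s cards1.
- exact: extension_acyclic.
move=> p; rewrite extension_morse_number // crit_new big_set1 perf_g.
rewrite /conley morse_s (rank_homology_cell p complexK sK dim_s).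
by rewrite (betti_top_cell p complexL dim_s oK bo0 oo1).
Qed.

(** By induction on the collapse: [g] is first extended over the complex left by the first pair, and
    that pair is added back last. *)
Lemma collapses_component_perfect K L g :
    collapses K L -> is_complex K -> component_perfect L g ->
  exists2 f : {set V} -> 'rV[R]_k, component_perfect K f & {in L, f =1 g}.
Proof.
elim=> {K L} [K _ perf_g|K L s t pair_st collKL IH complexK perf_g].
  by exists g.
have [f perf_f eq_fg] := IH (collapse_complex complexK pair_st) perf_g.
exists (extension (K :\: [set s; t]) f).
  exact: collapse_component_perfect.
move=> u uL; rewrite extensionE ?eq_fg //.
exact: (fintype.subsetP (collapses_sub collKL)).
Qed.

End Spine.

Theorem theorem3p8 (R : realType) (V : finType) (n k : nat)
    (M N : {set {set V}}) (g : {set V} -> 'rV[R]_k) :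
  (0 < k)%N ->
  triangulated_closed_manifold R n M ->
  connected (realization R M) ->
  orientable n M ->
  is_closed_spine n M N ->
  component_perfect N g ->
  exists f : {set V} -> 'rV[R]_k,
    component_perfect M f /\ (forall s, s \in N -> f s = g s).
Proof.
move=> k_gt0 [complexM _] _ [c [c_unit cM bc0]].
move=> [s [sM dim_s [complexW [_ sub_NW] _ collWN _]]] perf_g.
have [h perf_h eq_hg] :=
  collapses_component_perfect k_gt0 collWN complexW perf_g.
exists (extension (M :\ s) h); split.
  apply: (top_cell_component_perfect k_gt0 complexM complexW sM dim_s cM bc0)
    => //.
  (* The orientation has coefficient 1 or -1 at the removed cell, so its square there is 1. *)
  by case: (c_unit s sM dim_s) => ->.
move=> t tN; rewrite extensionE ?eq_hg //.
exact: (fintype.subsetP sub_NW).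
Qed.
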